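(* Consider the $\text{PATH-R-FS}_\varepsilon$ algorithm with learning rate $\varepsilon>0$ and regularization parameter sequence $0<\bar\delta_0\le\bar\delta_1\le\cdots\le\bar\delta_K\le\bar\delta$, where $\varepsilon\le\bar\delta_0$. Let $k$ with $0\le k\le K$ denote the total number of iterations. Then the following hold: (i) (Lasso feasibility and average training error) for each $i=0,\ldots,k$, $\hat\beta^i$ provides an approximate solution to the Lasso problem for $\delta=\bar\delta_i$; more specifically, $\hat\beta^i$ is feasible for the Lasso problem for $\delta=\bar\delta_i$, and the following suboptimality bound holds with respect to the entire boosting profile: $$\frac{1}{k+1}\sum_{i=0}^k\left(L_n(\hat\beta^i)-L^*_{n,\bar\delta_i}\right)\le\frac{\bar\delta\,\|\mathbf{X}\hat\beta_{LS}\|_2^2}{2n\varepsilon(k+1)}+\frac{2\bar\delta\varepsilon}{n};$$ (ii) ($\ell_1$-shrinkage of coefficients) $\|\hat\beta^i\|_1\le\bar\delta_i$ for $i=0,\ldots,k$; (iii) (sparsity of coefficients) $\|\hat\beta^i\|_0\le i$ for $i=0,\ldots,k$.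
   Context: Standing data: $\mathbf{X}=[\mathbf{X}_1,\ldots,\mathbf{X}_p]\in\mathbb{R}^{n\times p}$ has columns with zero mean and unit $\ell_2$ norm, and $\mathbf{y}\in\mathbb{R}^n$ has zero mean. $L_n(\beta):=\frac{1}{2n}\|\mathbf{y}-\mathbf{X}\beta\|_2^2$. A least squares solution $\hat\beta_{LS}$ is any minimizer of $L_n$ over $\mathbb{R}^p$; $\mathbf{X}\hat\beta_{LS}$ does not depend on which minimizer is chosen. The Lasso problem with parameter $\delta$ is $L^*_{n,\delta}:=\min\{L_n(\beta):\beta\in\mathbb{R}^p,\ \|\beta\|_1\le\delta\}$; $\beta$ is feasible for it if $\|\beta\|_1\le\delta$. $\|v\|_0$ is the number of nonzero entries of $v$. $\mathrm{sgn}(a)\in\{-1,0,1\}$ is the sign of $a$, with $\mathrm{sgn}(0)=0$. $e_j$ is the $j$-th unit vector. Algorithm $\text{PATH-R-FS}_\varepsilon$: initialize $\hat r^0=\mathbf{y}$, $\hat\beta^0=0$. For $k=0,1,\ldots,K$: choose any $j_k\in\arg\max_{j\in\{1,\ldots,p\}}|(\hat r^k)^T\mathbf{X}_j|$, set $\hat r^{k+1}=\hat r^k-\varepsilon\left[\mathrm{sgn}((\hat r^k)^T\mathbf{X}_{j_k})\mathbf{X}_{j_k}+(\hat r^k-\mathbf{y})/\bar\delta_k\right]$ and $\hat\beta^{k+1}=(1-\varepsilon/\bar\delta_k)\hat\beta^k+\varepsilon\,\mathrm{sgn}((\hat r^k)^T\mathbf{X}_{j_k})e_{j_k}$. *)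

(* Defs.v *)
From mathcomp Require Import all_boot all_order all_algebra.
From mathcomp Require Import all_classical all_reals all_analysis.

Set Implicit Arguments.
Unset Strict Implicit.
Unset Printing Implicit Defensive.

Import Order.TTheory GRing.Theory Num.Theory.
Import numFieldNormedType.Exports.

Local Open Scope classical_set_scope.
Local Open Scope ring_scope.

Section Vectors.
Context {R : realType} {m : nat}.
Implicit Types u v : 'cV[R]_m.

Definition mean v : R := (\sum_i v i 0) / m%:R.
Definition inner u v : R := (u^T *m v) 0 0.

(* The norm `|v| that the library puts on matrices is the sup norm. *)
Definition norm2 v : R := Num.sqrt (\sum_i v i 0 ^+ 2).
Definition norm1 v : R := \sum_i `|v i 0|.
Definition norm0 v : nat := #|[set i | v i 0 != 0]%SET|.

End Vectors.

Section Regression.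
Context {R : realType} {n p : nat}.
Variables (X : 'M[R]_(n, p)) (y : 'cV[R]_n).

Definition standardized : Prop :=
  (forall j, mean (col j X) = 0 /\ norm2 (col j X) = 1) /\ mean y = 0.

Definition ls_loss (beta : 'cV[R]_p) : R :=
  (2 * n%:R)^-1 * norm2 (y - X *m beta) ^+ 2.

Definition is_least_squares (beta : 'cV[R]_p) : Prop :=
  forall beta', ls_loss beta <= ls_loss beta'.

Definition lasso_feasible (delta : R) : set 'cV[R]_p :=
  [set beta | norm1 beta <= delta].

(* For 0 <= delta this infimum is a minimum (lasso_valueP). *)
Definition lasso_value (delta : R) : R :=
  inf [set ls_loss beta | beta in lasso_feasible delta].

(* delta k is meaningful for k <= K and the iterates for k <= K.+1. *)
Record path_rfs (eps : R) (delta : nat -> R) (K : nat) (j : nat -> 'I_p)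
    (r : nat -> 'cV[R]_n) (beta : nat -> 'cV[R]_p) : Prop := PathRFS {
  path_rfs_r0 : r 0%N = y;
  path_rfs_beta0 : beta 0%N = 0;
  path_rfs_argmax : forall k, (k <= K)%N -> forall l : 'I_p,
    `|inner (r k) (col l X)| <= `|inner (r k) (col (j k) X)|;
  path_rfs_r : forall k, (k <= K)%N ->
    r k.+1 = r k - eps *: (Num.sg (inner (r k) (col (j k) X)) *: col (j k) X
                           + (delta k)^-1 *: (r k - y));
  path_rfs_beta : forall k, (k <= K)%N ->
    beta k.+1 = (1 - eps / delta k) *: beta k
      + (eps * Num.sg (inner (r k) (col (j k) X))) *: delta_mx (j k) 0
}.

End Regression.

Section WellDefined.
Context {R : realType} {n p : nat}.
Variables (X : 'M[R]_(n, p)) (y : 'cV[R]_n).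

Lemma norm2_sqr m (v : 'cV[R]_m) : norm2 v ^+ 2 = \sum_i v i 0 ^+ 2.
Proof. by rewrite sqr_sqrtr// sumr_ge0// => i _; exact: sqr_ge0. Qed.

Lemma ls_loss_ge0 beta : 0 <= ls_loss X y beta.
Proof. by rewrite mulr_ge0 ?sqr_ge0// invr_ge0 mulr_ge0. Qed.

Lemma sumf_continuous (T : topologicalType) (I : finType) (F : I -> T -> R) :
  (forall i, continuous (F i)) -> continuous (fun x => \sum_i F i x).
Proof.
by move=> cF; apply: continuous_big => [|i _]; [exact: add_continuous|exact: cF].
Qed.

Lemma mulf_continuous (T : topologicalType) (a : R) (f : T -> R) :
  continuous f -> continuous (fun x => a * f x).
Proof. by move=> cf x; apply: cvgMl_tmp; exact: cf. Qed.

Lemma sqrBf_continuous (T : topologicalType) (a : R) (f : T -> R) :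
  continuous f -> continuous (fun x => (a - f x) ^+ 2).
Proof.
by move=> cf x; apply: cvgM; apply: cvgB; (exact: cvg_cst || exact: cf).
Qed.

Lemma normf_continuous (T : topologicalType) (f : T -> R) :
  continuous f -> continuous (fun x => `|f x|).
Proof. by move=> cf x; apply: cvg_norm; exact: cf. Qed.

Lemma lasso_valueP (delta : R) : 0 <= delta ->
  exists2 beta, lasso_feasible delta beta &
    lasso_value X y delta = ls_loss X y beta
    /\ forall beta', lasso_feasible delta beta' ->
         ls_loss X y beta <= ls_loss X y beta'.
Proof.
move=> d0; pose A : set 'rV[R]_p := [set v | \sum_i `|v 0 i| <= delta].
pose f (v : 'rV[R]_p) := ls_loss X y v^T.
have cf : continuous f.
  have -> : f = fun v : 'rV[R]_p => (2 * n%:R)^-1 *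
      \sum_i (y i 0 - \sum_j X i j * v 0 j) ^+ 2.
    apply/funext => v; rewrite /f /ls_loss norm2_sqr; congr (_ * _).
    apply: eq_bigr => i _; rewrite !mxE; congr ((_ - _) ^+ 2).
    by apply: eq_bigr => l _; rewrite mxE.
  apply: mulf_continuous; apply: sumf_continuous => i.
  apply: sqrBf_continuous; apply: sumf_continuous => l.
  by apply: mulf_continuous; exact: coord_continuous.
have cA : compact A.
  apply: bounded_closed_compact.
    exists delta; split; first exact: num_real.
    move=> x dx v vA; apply: le_trans (ltW dx); apply: le_trans vA.
    rewrite [leLHS]/Num.norm /= mx_normrE; apply/bigmax_leP; split=> /=.
      by rewrite sumr_ge0.
    move=> [i l] _ /=; rewrite ord1 (bigD1 l)//= lerDl.
    by rewrite sumr_ge0.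
  have -> : A = (fun v : 'rV[R]_p => \sum_i `|v 0 i|) @^-1` [set x | x <= delta].
    by [].
  apply: preimage_closed => [v _|]; last exact: closed_le.
  have cN : continuous (fun v : 'rV[R]_p => \sum_i `|v 0 i|).
    by apply: sumf_continuous => i; apply: normf_continuous;
      exact: coord_continuous.
  exact: cN.
have A0 : A !=set0.
  by exists 0; rewrite /A /= big1// => i _; rewrite mxE normr0.
have [c cinA cmin] := compact_EVT_min A0 cA (continuous_subspaceT cf).
have fA b : lasso_feasible delta b -> A b^T.
  by rewrite /A/= => h; apply: le_trans h; apply: ler_sum => i _; rewrite mxE.
have cF : lasso_feasible delta c^T.
  move: cinA; rewrite inE /A/=; apply: le_trans.
  by rewrite /norm1; apply: ler_sum => i _; rewrite mxE.
have cM b : lasso_feasible delta b -> ls_loss X y c^T <= ls_loss X y b.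
  by move=> /fA bA; have := cmin b^T; rewrite inE /f trmxK; apply.
exists c^T => //; split=> //; apply/eqP; rewrite eq_le; apply/andP; split.
  apply: ge_inf; last by exists c^T.
  by exists 0 => _ [b _ <-]; exact: ls_loss_ge0.
apply: lb_le_inf; first by exists (ls_loss X y c^T), c^T.
by move=> _ [b bF <-]; exact: cM.
Qed.

Lemma is_least_squares_exists : exists beta, is_least_squares X y beta.
Proof.
have kerE : (kermx (X^T *m X) <= kermx X^T)%MS.
  apply/sub_kermxP/row_matrixP => i; rewrite row0 row_mul.
  set v := row i _; have hv : v *m X^T *m X = 0.
    by rewrite -mulmxA -row_mul mulmx_ker row0.
  apply/rowP => l; rewrite [RHS]mxE; set w := v *m X^T in hv *.
  have : (w *m w^T) 0 0 = 0.
    by rewrite {2}/w trmx_mul trmxK mulmxA hv mul0mx mxE.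
  rewrite mxE => /eqP; rewrite psumr_eq0; last first.
    by move=> s _; rewrite [w^T _ _]mxE -expr2 sqr_ge0.
  move=> /allP /(_ l (mem_index_enum _)).
  by rewrite /= [w^T _ _]mxE -expr2 sqrf_eq0 => /eqP.
have subX : (X <= X^T *m X)%MS.
  rewrite -(geq_leqif (mxrank_leqif_sup (submxMl X^T X))).
  have := mxrankS kerE; rewrite !mxrank_ker mxrank_tr.
  by rewrite leq_sub2lE// rank_leq_col.
have /submxP [b hb] : (y^T *m X <= X^T *m X)%MS := submx_trans (submxMl _ _) subX.
exists b^T => b'; rewrite /ls_loss ler_wpM2l ?invr_ge0 ?mulr_ge0//.
have nE (v : 'cV[R]_n) : norm2 v ^+ 2 = (v^T *m v) 0 0.
  by rewrite norm2_sqr mxE; apply: eq_bigr => i _; rewrite mxE expr2.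
set u := y - X *m b^T; set w := X *m (b^T - b').
have -> : y - X *m b' = u + w.
  by rewrite /u /w mulmxBr addrA subrK.
have uw : u^T *m w = 0.
  by rewrite /u /w linearB /= trmx_mul trmxK mulmxA mulmxBl hb mulmxA subrr mul0mx.
have wu : w^T *m u = 0 by rewrite -[LHS]trmxK trmx_mul trmxK uw trmx0.
clearbody u w; rewrite (nE (u + w)) [(u + w)^T]linearD /= mulmxDl !mulmxDr uw wu addr0 add0r [leRHS]mxE.
by rewrite -!nE lerDl sqr_ge0.
Qed.

End WellDefined.

(* Main.v *)
Require Import Defs.
From mathcomp Require Import all_boot all_order all_algebra.
From mathcomp Require Import all_classical all_reals all_analysis.
From mathcomp Require Import ring lra.

Set Implicit Arguments.
Unset Strict Implicit.
Unset Printing Implicit Defensive.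

Import Order.TTheory GRing.Theory Num.Theory.
Import numFieldNormedType.Exports.

Local Open Scope ring_scope.

(** The residual of the iterate [beta i] is [r i = y - X beta i], and the
    update of [r] is a subgradient step of length [eps], along
      [g i = sgn (r i . X_(j i)) X_(j i) + (r i - y) / delta i],
    for the convex function [max_l |r . X_l| + |r - y|^2 / (2 delta i)].  Take
    the least squares residual [rLS] as reference point.  It is orthogonal to
    the column space of [X], which contains both [X_(j i)] and [r i - y], so
      [g i . (r i - rLS) = |r i . X_(j i)| - (r i . X beta i) / delta i =: G i]
    whatever [delta i] is: this is what makes one fixed reference point work
    for the whole sequence of Lasso problems.

    Up to the factor [delta i / n], the number [G i] is the Frank-Wolfe duality
    gap of the Lasso problem at [beta i].  Linearizing the convex loss therefore
    bounds the suboptimality of [beta i] by [delta i * G i / n]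
    ([lasso_suboptimality_le]), and [0 <= G i] because [beta i] is feasible.
    Expanding the square of [r i - eps g i - rLS] gives
      [2 eps G i = |r i - rLS|^2 - |r i.+1 - rLS|^2 + eps^2 |g i|^2]
    with [|g i|^2 <= 4] ([rfs_step_potential]).  As [G i] is nonnegative,
    [delta i] can be replaced by [deltabar] before summing; the squared
    distances then telescope from [|r 0 - rLS|^2 = |X betaLS|^2].

    Feasibility holds because [beta i.+1] is a convex combination of [beta i]
    and a point of the [l1] ball of radius [delta i], namely plus or minus
    [delta i] times a unit vector; sparsity holds because each step changes at
    most one zero coordinate. *)

(** * Inner products and norms *)

Section InnerProduct.
Context {R : realType} {m : nat}.
Implicit Types u v w : 'cV[R]_m.

Lemma innerE u v : inner u v = \sum_i u i 0 * v i 0.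
Proof. by rewrite /inner mxE; apply: eq_bigr => i _; rewrite mxE. Qed.

Lemma innerC u v : inner u v = inner v u.
Proof. by rewrite !innerE; apply: eq_bigr => i _; rewrite mulrC. Qed.

Lemma innerDr u v w : inner u (v + w) = inner u v + inner u w.
Proof. by rewrite /inner mulmxDr mxE. Qed.

Lemma innerZr a u v : inner u (a *: v) = a * inner u v.
Proof. by rewrite /inner -scalemxAr mxE. Qed.

Lemma innerNr u v : inner u (- v) = - inner u v.
Proof. by rewrite /inner mulmxN mxE. Qed.

Lemma innerDl u v w : inner (u + v) w = inner u w + inner v w.
Proof. by rewrite innerC innerDr !(innerC w). Qed.

Lemma innerZl a u v : inner (a *: u) v = a * inner u v.
Proof. by rewrite innerC innerZr innerC. Qed.

Lemma innerNl u v : inner (- u) v = - inner u v.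
Proof. by rewrite innerC innerNr innerC. Qed.

Definition inner_linE :=
  (innerDr, innerDl, innerNr, innerNl, innerZr, innerZl).

Lemma norm2_inner u : norm2 u ^+ 2 = inner u u.
Proof. by rewrite norm2_sqr innerE; apply: eq_bigr => i _; rewrite expr2. Qed.

Lemma inner_ge0 u : 0 <= inner u u.
Proof. by rewrite -norm2_inner sqr_ge0. Qed.

Lemma norm2_sqrD_le u v :
  norm2 (u + v) ^+ 2 <= 2 * norm2 u ^+ 2 + 2 * norm2 v ^+ 2.
Proof.
rewrite !norm2_inner; have := inner_ge0 (u - v).
by rewrite !inner_linE (innerC v u); lra.
Qed.

Lemma norm_inner_le1 u v : norm2 u = 1 -> norm2 v = 1 -> `|inner u v| <= 1.
Proof.
move=> nu nv; have uu : inner u u = 1 by rewrite -norm2_inner nu expr1n.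
have vv : inner v v = 1 by rewrite -norm2_inner nv expr1n.
have := inner_ge0 (u - v); have := inner_ge0 (u + v).
rewrite !inner_linE (innerC v u) uu vv ler_norml => h1 h2.
by apply/andP; split; lra.
Qed.

End InnerProduct.

Section DesignMatrix.
Context {R : realType} {n p : nat}.
Variables (X : 'M[R]_(n, p)) (y : 'cV[R]_n).
Implicit Types b : 'cV[R]_p.

Lemma inner_mulmx (v : 'cV[R]_n) b :
  inner v (X *m b) = \sum_l b l 0 * inner v (col l X).
Proof.
rewrite {1}/inner mulmxA mxE; apply: eq_bigr => l _.
rewrite mulrC innerE mxE; congr (_ * _).
by apply: eq_bigr => i _; rewrite !mxE.
Qed.

(** Hoelder's inequality for the pairing of the [l1] and sup norms, applied to
    [b] and [X^T v]. *)
Lemma inner_mulmx_le (v : 'cV[R]_n) b (M : R) :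
  (forall l, `|inner v (col l X)| <= M) ->
  `|inner v (X *m b)| <= norm1 b * M.
Proof.
move=> vM; rewrite inner_mulmx (le_trans (ler_norm_sum _ _ _))//.
by rewrite /norm1 mulr_suml ler_sum// => l _; rewrite normrM ler_wpM2l.
Qed.

(** The Gram matrix of unit columns has entries in [[-1, 1]], so its quadratic
    form is bounded by two applications of Hoelder's inequality. *)
Lemma norm2_mulmx_le_norm1 b :
  (forall l, norm2 (col l X) = 1) -> norm2 (X *m b) ^+ 2 <= norm1 b ^+ 2.
Proof.
move=> X1; rewrite norm2_inner expr2 (le_trans (ler_norm _))//.
apply: inner_mulmx_le => l; rewrite innerC -[leRHS]mulr1.
by apply: inner_mulmx_le => l'; exact: norm_inner_le1.
Qed.

(** * Least squares and Lasso *)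

(** If [c = rLS . X v] were nonzero, a short move from [b] along [v] would
    decrease the loss. *)
Lemma least_squares_orthogonal b v :
  is_least_squares X y b -> inner (y - X *m b) (X *m v) = 0.
Proof.
have [n0|n_gt0] := posnP n.
  by move=> _; rewrite innerE big1// => -[i i_lt]; have := leq_trans i_lt (eq_leq n0).
set u := y - _; set c := inner _ _; pose q := inner (X *m v) (X *m v).
have q0 : 0 <= q := inner_ge0 _.
(* With [1 + q] in place of [q], the step also makes sense when [X v = 0]. *)
pose t := c / (1 + q); have ct : c = t * (1 + q) by rewrite /t divfK//; lra.
move=> /(_ (b + t *: v)); rewrite /ls_loss ler_pM2l; last first.
  by rewrite invr_gt0 mulr_gt0// ltr0n.
have -> : y - X *m (b + t *: v) = u - t *: (X *m v).
  by rewrite mulmxDr -scalemxAr opprD addrA.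
rewrite -/u; move: u @c @t ct => u c t ct.
rewrite !norm2_inner !inner_linE (innerC (X *m v) u) -/c -/q ct => h.
suff -> : t = 0 by rewrite mul0r.
(* Substituting [c = t * (1 + q)] in [h] leaves [t ^+ 2 * (2 + q) <= 0]. *)
by apply/eqP; rewrite -sqrf_eq0 eq_le sqr_ge0 andbT; nra.
Qed.

(** The bound is the Frank-Wolfe duality gap: the loss lies above its
    linearization at [b], and the linear form [r . X b'] is at most [d * M] on
    the [l1] ball of radius [d]. *)
Lemma lasso_suboptimality_le b (d M : R) : 0 <= d -> 0 <= M ->
  (forall l, `|inner (y - X *m b) (col l X)| <= M) ->
  ls_loss X y b - lasso_value X y d <=
    n%:R^-1 * (d * M - inner (y - X *m b) (X *m b)).
Proof.
move=> d0 M0 rM; have [b' fb' [-> _]] := lasso_valueP X y d0.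
have rb' : inner (y - X *m b) (X *m b') <= d * M.
  rewrite (le_trans (ler_norm _))// (le_trans (inner_mulmx_le _ rM))//.
  by rewrite ler_wpM2r.
set u := y - _ in rM rb' *; set w := X *m b - X *m b'.
have -> : ls_loss X y b' = (2 * n%:R)^-1 * norm2 (u + w) ^+ 2.
  by rewrite /u /w addrA subrK.
rewrite /ls_loss -/u !norm2_inner -mulrBr invfM -mulrA [leLHS]mulrCA.
rewrite ler_wpM2l ?invr_ge0//.
have uw : inner u w = inner u (X *m b) - inner u (X *m b').
  by rewrite innerDr innerNr.
clearbody u w; have := inner_ge0 w.
by rewrite !inner_linE (innerC w u) uw; lra.
Qed.

(** * One step of the algorithm *)

Lemma norm1_shrink_step b l (c a : R) : 0 <= c ->
  norm1 (c *: b + a *: delta_mx l 0) <= c * norm1 b + `|a|.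
Proof.
move=> c0; rewrite /norm1 (bigD1 l)//= [in leRHS](bigD1 l)//= mulrDr mulr_sumr.
rewrite addrAC lerD//.
  by rewrite !mxE !eqxx mulr1 (le_trans (ler_normD _ _))// normrM (ger0_norm c0).
apply: ler_sum => i il; rewrite !mxE (negPf il) mulr0 addr0 normrM.
by rewrite ger0_norm.
Qed.

Lemma norm0_shrink_step b l (c a : R) :
  (norm0 (c *: b + a *: delta_mx l 0)%R <= (norm0 b).+1)%N.
Proof.
apply: (@leq_trans #|l |: [set i | b i 0 != 0]%SET|); last first.
  by rewrite cardsU1 -[leqRHS]add1n leq_add2r leq_b1.
apply/subset_leq_card/fintype.subsetP => i; rewrite !inE !mxE.
have [//|il] := eqVneq i l; rewrite mulr0 addr0.
by apply: contraNneq => ->; rewrite mulr0.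
Qed.

(** The scaled duality gap [G = |r . X_l| - (r . X b) / d] is the inner product
    of the step direction [g] with [r - rLS], for every least squares residual
    [rLS]; hence a gap [G] decreases the squared distance from [r] to [rLS] by
    at least [2 eps G - 4 eps^2].  The constant [4] comes from
    [|g|^2 <= 2 |X_l|^2 + 2 |X b|^2 / d^2]. *)
Lemma rfs_step_potential b l (d eps : R) betaLS :
  (forall l', norm2 (col l' X) = 1) -> is_least_squares X y betaLS ->
  0 < d -> norm1 b <= d ->
  let r := y - X *m b in
  let rLS := y - X *m betaLS in
  let g := Num.sg (inner r (col l X)) *: col l X + d^-1 *: (r - y) in
  2 * eps * (`|inner r (col l X)| - inner r (X *m b) / d) <=
    norm2 (r - rLS) ^+ 2 - norm2 (r - eps *: g - rLS) ^+ 2 + 4 * eps ^+ 2.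
Proof.
move=> X1 LS d0 bd /=; set r := y - X *m b; set rLS := y - X *m betaLS.
set s := Num.sg _; set g := (Z in eps *: Z); set G := (Z in 2 * eps * Z).
have ry : r - y = - (X *m b) by rewrite /r addrAC subrr sub0r.
have orth v : inner (X *m v) rLS = 0.
  by rewrite innerC; exact: least_squares_orthogonal.
have colX : col l X = X *m delta_mx l 0 by rewrite colE.
clearbody r rLS.
have gG : inner g (r - rLS) = G.
  rewrite /g ry !inner_linE colX !orth -colX /G normrEsg -/s.
  by rewrite (innerC (X *m b)) (innerC (col l X)); ring.
have g4 : norm2 g ^+ 2 <= 4.
  rewrite (le_trans (norm2_sqrD_le _ _))// ry.
  have -> : norm2 (s *: col l X) ^+ 2 = s ^+ 2 * norm2 (col l X) ^+ 2.
    by rewrite !norm2_inner !inner_linE; ring.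
  have -> : norm2 (d^-1 *: - (X *m b)) ^+ 2 = norm2 (X *m b) ^+ 2 / d ^+ 2.
    by rewrite !norm2_inner !inner_linE; field; rewrite gt_eqF.
  have s1 : s ^+ 2 <= 1 by rewrite sqr_sg lern1 leq_b1.
  have Xb1 : norm2 (X *m b) ^+ 2 / d ^+ 2 <= 1.
    rewrite ler_pdivrMr ?exprn_gt0// mul1r.
    rewrite (le_trans (norm2_mulmx_le_norm1 _ X1))// lerXn2r ?nnegrE ?(ltW d0)//.
    by rewrite /norm1 sumr_ge0.
  by rewrite X1 expr1n; lra.
have -> : r - eps *: g - rLS = (r - rLS) - eps *: g by rewrite addrAC.
rewrite -gG; move: g4; rewrite !norm2_inner.
clearbody g; move: (r - rLS) => e.
rewrite !inner_linE (innerC e g) => g4.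
by have := sqr_ge0 eps; nra.
Qed.

End DesignMatrix.

(** * Iterates of the algorithm *)

Section Run.
Context {R : realType} {n p : nat}.
Variables (X : 'M[R]_(n, p)) (y : 'cV[R]_n).
Variables (eps : R) (delta : nat -> R) (K : nat) (j : nat -> 'I_p).
Variables (r : nat -> 'cV[R]_n) (beta : nat -> 'cV[R]_p).
Hypothesis hrun : path_rfs X y eps delta K j r beta.

Lemma path_rfs_residual i : (i <= K.+1)%N -> r i = y - X *m beta i.
Proof.
elim: i => [_|i IH iK].
  by rewrite (path_rfs_r0 hrun) (path_rfs_beta0 hrun) mulmx0 subr0.
rewrite (path_rfs_r hrun iK) (path_rfs_beta hrun iK).
move: (Num.sg _) => s; rewrite (IH (leqW iK)) mulmxDr -!scalemxAr -colE.
by apply/matrixP => a b; rewrite !mxE; ring.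
Qed.

Lemma path_rfs_norm0 i : (i <= K.+1)%N -> (norm0 (beta i) <= i)%N.
Proof.
elim: i => [_|i IH iK].
  by rewrite (path_rfs_beta0 hrun) leqn0 cards_eq0; apply/eqP/setP => a;
    rewrite !inE mxE eqxx.
rewrite (path_rfs_beta hrun iK) (leq_trans (norm0_shrink_step _ _ _ _))//.
by rewrite ltnS IH// ltnW.
Qed.

Hypothesis delta_mono : forall i, (i < K)%N -> delta i <= delta i.+1.

Lemma delta_le i k : (i <= k)%N -> (k <= K)%N -> delta i <= delta k.
Proof.
elim: k => [|k IH]; first by rewrite leqn0 => /eqP ->.
rewrite leq_eqVlt => /predU1P[->//|ik kK].
by rewrite (le_trans (IH ik (ltnW kK)))// delta_mono.
Qed.

Hypotheses (eps_gt0 : 0 < eps) (eps_delta : eps <= delta 0%N).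

Lemma delta_gt0 i : (i <= K)%N -> 0 < delta i.
Proof.
move=> iK; apply: lt_le_trans eps_gt0 _.
by rewrite (le_trans eps_delta)// delta_le.
Qed.

Lemma path_rfs_feasible i : (i <= K)%N -> norm1 (beta i) <= delta i.
Proof.
elim: i => [_|i IH iK].
  rewrite (path_rfs_beta0 hrun) /norm1 big1 ?ltW ?delta_gt0// => a _.
  by rewrite mxE normr0.
have di : 0 < delta i by rewrite delta_gt0// ltnW.
have ed : eps / delta i <= 1.
  by rewrite ler_pdivrMr// mul1r (le_trans eps_delta)// delta_le// ltnW.
rewrite (path_rfs_beta hrun (ltnW iK)) (le_trans _ (delta_mono iK))//.
apply: le_trans (norm1_shrink_step _ _ _ _) _; first by rewrite subr_ge0.
rewrite [leRHS](_ : _ = (1 - eps / delta i) * delta i + eps * 1); last first.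
  by field; rewrite gt_eqF.
rewrite lerD//; first by rewrite ler_wpM2l ?subr_ge0 ?IH// ltnW.
rewrite normrM (gtr0_norm eps_gt0) ler_pM2l// normr_sg.
by rewrite lern1 leq_b1.
Qed.

Hypothesis X1 : forall l, norm2 (col l X) = 1.
Variable deltabar : R.
Hypothesis hdeltabar : delta K <= deltabar.

(** Suboptimality of [beta i] against decrease of the squared distance to the
    least squares residual.  The gap being nonnegative, the factor [delta i] in
    front of it can be enlarged to [deltabar], which does not depend on [i]. *)
Lemma path_rfs_suboptimality betaLS i : is_least_squares X y betaLS ->
  (i <= K)%N ->
  ls_loss X y (beta i) - lasso_value X y (delta i) <=
  n%:R^-1 * deltabar * (2 * eps)^-1 *
    (norm2 (r i - (y - X *m betaLS)) ^+ 2
     - norm2 (r i.+1 - (y - X *m betaLS)) ^+ 2 + 4 * eps ^+ 2).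
Proof.
move=> LS iK; have di := delta_gt0 iK; have bi := path_rfs_feasible iK.
have ri := path_rfs_residual (leqW iK).
set M := `|inner (r i) (col (j i) X)|.
have rM l : `|inner (y - X *m beta i) (col l X)| <= M.
  by rewrite -ri; exact: (path_rfs_argmax hrun iK l).
have M0 : 0 <= M by exact: normr_ge0.
have gap := lasso_suboptimality_le (ltW di) M0 rM.
have /= pot := rfs_step_potential (j i) eps X1 LS di bi.
rewrite (path_rfs_r hrun iK); rewrite -ri -/M in gap pot *.
set G := M - _ in pot.
have G0 : 0 <= G.
  rewrite subr_ge0 ler_pdivrMr// (le_trans (ler_norm _))//.
  rewrite (@le_trans _ _ (norm1 (beta i) * M))//; last by rewrite mulrC ler_wpM2l.
  by apply: inner_mulmx_le => l; exact: (path_rfs_argmax hrun iK l).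
apply: le_trans gap _; rewrite -!mulrA ler_wpM2l ?invr_ge0//.
have -> : delta i * M - inner (r i) (X *m beta i) = delta i * G.
  by rewrite /G; field; rewrite gt_eqF.
have dd : delta i <= deltabar by rewrite (le_trans _ hdeltabar)// delta_le.
apply: (@le_trans _ _ (deltabar * G)); first by rewrite ler_wpM2r.
rewrite ler_wpM2l ?(le_trans (ltW di))//.
by rewrite ler_pdivlMl ?mulr_gt0.
Qed.

End Run.

Theorem theorem5p1 (R : realType) (n p : nat)
    (X : 'M[R]_(n, p)) (y : 'cV[R]_n) (hXy : standardized X y)
    (eps : R) (delta : nat -> R) (deltabar : R) (K : nat)
    (heps : 0 < eps) (hdelta0 : 0 < delta 0%N)
    (hdelta_mono : forall i, (i < K)%N -> delta i <= delta i.+1)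
    (hdeltabar : delta K <= deltabar)
    (heps_delta : eps <= delta 0%N)
    (j : nat -> 'I_p) (r : nat -> 'cV[R]_n) (beta : nat -> 'cV[R]_p)
    (hrun : path_rfs X y eps delta K j r beta)
    (k : nat) (hk : (k <= K)%N) :
  [/\ (forall i, (i <= k)%N -> lasso_feasible (delta i) (beta i))
      /\ (forall betaLS : 'cV[R]_p, is_least_squares X y betaLS ->
          (k.+1)%:R^-1 * \sum_(i < k.+1)
            (ls_loss X y (beta i) - lasso_value X y (delta i))
          <= deltabar * norm2 (X *m betaLS) ^+ 2
               / (2 * n%:R * eps * (k.+1)%:R)
             + 2 * deltabar * eps / n%:R),
      (forall i, (i <= k)%N -> norm1 (beta i) <= delta i)
    & (forall i, (i <= k)%N -> (norm0 (beta i) <= i)%N)].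
Proof.
have feas i : (i <= k)%N -> norm1 (beta i) <= delta i.
  by move=> ik; exact: (path_rfs_feasible hrun hdelta_mono heps heps_delta (leq_trans ik hk)).
split => //; last first.
  by move=> i ik; exact: (path_rfs_norm0 hrun (leqW (leq_trans ik hk))).
split=> // betaLS LS; have X1 l : norm2 (col l X) = 1 by case: hXy => /(_ l)[].
pose D i := norm2 (r i - (y - X *m betaLS)) ^+ 2.
have D0 : D 0%N = norm2 (X *m betaLS) ^+ 2.
  by rewrite /D (path_rfs_r0 hrun) opprB addrC subrK.
have db0 : 0 <= deltabar.
  by rewrite (le_trans _ hdeltabar)// ltW// (delta_gt0 hdelta_mono heps).
have sumle : \sum_(i < k.+1)
    (ls_loss X y (beta i) - lasso_value X y (delta i)) <=
    n%:R^-1 * deltabar * (2 * eps)^-1 * (D 0%N + k.+1%:R * (4 * eps ^+ 2)).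
  apply: (@le_trans _ _ (\sum_(i < k.+1) n%:R^-1 * deltabar * (2 * eps)^-1 *
      (D i - D i.+1 + 4 * eps ^+ 2))).
    apply: ler_sum => i _; have iK : (i <= K)%N by rewrite (leq_trans _ hk)// -ltnS.
    exact: (path_rfs_suboptimality hrun).
  rewrite -mulr_sumr ler_wpM2l//.
    by rewrite !mulr_ge0 ?invr_ge0// mulr_ge0// ltW.
  rewrite big_split/= sumr_const card_ord -(mulr_natl (4 * _)) lerD2r.
  rewrite -(big_mkord xpredT (fun i => D i - D i.+1)).
  under eq_bigr do rewrite -opprB.
  by rewrite sumrN telescope_sumr// opprB gerBl sqr_ge0.
have k0 : k.+1%:R != 0 :> R by rewrite pnatr_eq0.
apply: (@le_trans _ _ (k.+1%:R^-1 * (n%:R^-1 * deltabar * (2 * eps)^-1 *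
    (D 0%N + k.+1%:R * (4 * eps ^+ 2))))); first by rewrite ler_wpM2l.
rewrite D0 le_eqVlt; apply/orP; left; apply/eqP.
(* As [n%:R] may be zero, its inverse is treated as an atom. *)
rewrite !invfM; move: (n%:R^-1) (norm2 _) (k.+1%:R) k0 => c N k1 k0.
by field; rewrite k0 gt_eqF.
Qed.
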